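(* Let $n$ be an arbitrary positive integer. Suppose a Hausdorff topological semigroup $S$ satisfies one of the following conditions: (i) $S$ is compact; (ii) $S$ is $\Gamma$-compact; (iii) $S$ is a countably compact topological inverse semigroup; (iv) the square $S\times S$ is countably compact; (v) the square $S\times S$ is a Tychonoff pseudocompact space. Then $S$ does not contain (a subsemigroup isomorphic to) the semigroup $\mathscr{IPF}(\mathbb{N}^n)$, and for every homomorphism $\mathfrak{h}\colon\mathscr{IPF}(\mathbb{N}^n)\to S$ the image $(\mathscr{IPF}(\mathbb{N}^n))\mathfrak{h}$ is a subgroup of $S$. Moreover, for every homomorphism $\mathfrak{h}\colon\mathscr{IPF}(\mathbb{N}^n)\to S$ there exists a unique homomorphism $\mathfrak{u}_{\mathfrak{h}}\colon\mathscr{S}_n\ltimes_{\Theta}(\mathbb{Z}(+))^n\to S$ such that $\mathfrak{h}$ equals the composition of $\Upsilon\colon\mathscr{IPF}(\mathbb{N}^n)\to\mathscr{S}_n\ltimes_{\Theta}(\mathbb{Z}(+))^n$ followed by $\mathfrak{u}_{\mathfrak{h}}$.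
   Context: $\mathbb{N}$ is the set of positive integers; $(\mathbb{N}^n,\leqslant)$ carries the product (coordinatewise) order; ${\uparrow}\mathbf{x}=\{\mathbf{y}\in\mathbb{N}^n:\mathbf{x}\leqslant\mathbf{y}\}$. $\mathscr{IPF}(\mathbb{N}^n)$ is the semigroup of all order isomorphisms between principal filters of $(\mathbb{N}^n,\leqslant)$, with composition of partial maps (maps written on the right, composed left to right, $z(\alpha\beta)=(z\alpha)\beta$ wherever defined). Homomorphisms are semigroup homomorphisms (no topology on $\mathscr{IPF}(\mathbb{N}^n)$ is involved). $\mathscr{S}_n$ is the group of permutations of $\{1,\ldots,n\}$ (acting on the right, composed left to right); for a tuple $\mathbf{z}\in\mathbb{Z}^n$, $(\mathbf{z})\sigma=(z_{(1)\sigma^{-1}},\ldots,z_{(n)\sigma^{-1}})$. $\mathscr{S}_n\ltimes_\Theta(\mathbb{Z}(+))^n$ is the set $\mathscr{S}_n\times\mathbb{Z}^n$ with multiplication $(\sigma,\mathbf{z})(\tau,\mathbf{w})=(\sigma\tau,(\mathbf{z})\tau+\mathbf{w})$. For $\alpha\in\mathscr{IPF}(\mathbb{N}^n)$, $\mathbf{x}_\alpha,\mathbf{y}_\alpha$ are defined by $\operatorname{dom}\alpha={\uparrow}\mathbf{x}_\alpha$, $\operatorname{ran}\alpha={\uparrow}\mathbf{y}_\alpha$, and $\sigma_\alpha\in\mathscr{S}_n$ is the unique permutation with $(\mathbf{z})\alpha=(\mathbf{z}-\mathbf{x}_\alpha+\mathbf{1})\sigma_\alpha+\mathbf{y}_\alpha-\mathbf{1}$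 for all $\mathbf{z}\in\operatorname{dom}\alpha$, $\mathbf{1}=(1,\ldots,1)$. The map $\Upsilon$ is the homomorphism $(\alpha)\Upsilon=(\sigma_\alpha,(\mathbf{x}_\alpha)\sigma_\alpha-\mathbf{y}_\alpha)$. A topological semigroup is a topological space with a (jointly) continuous semigroup operation; a topological inverse semigroup is an inverse topological semigroup with continuous inversion. All spaces are Hausdorff. A topological semigroup $S$ is $\Gamma$-compact if for every $x\in S$ the closure of $\{x,x^2,x^3,\ldots\}$ is compact in $S$. A space is countably compact if each of its closed discrete subspaces is finite; it is pseudocompact if it is Tychonoff and every continuous real-valued function on it is bounded. *)

(* Defs.v *)
From HB Require Import structures.
From mathcomp Require Import all_boot all_order all_algebra all_fingroup.
From mathcomp Require Import all_classical all_reals all_analysis.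
Import numFieldNormedType.Exports.

Set Implicit Arguments.
Unset Strict Implicit.
Unset Printing Implicit Defensive.

Local Open Scope classical_set_scope.

HB.structure Definition PreTopologicalSemigroup :=
  {S of Topological S & Semigroup S}.

HB.mixin Record PreTopologicalSemigroup_isTopologicalSemigroup S
    & PreTopologicalSemigroup S := {
  mulg_continuous : continuous (fun p : S * S => (p.1 * p.2)%g)
}.

#[short(type="topologicalSemigroupType")]
HB.structure Definition TopologicalSemigroup :=
  {S of PreTopologicalSemigroup S
      & PreTopologicalSemigroup_isTopologicalSemigroup S}.

(* The set of the powers x ^ k.+1, for k : nat; a semigroup has no unit, hence
   no natexp. *)
Definition powers (S : semigroupType) (x : S) : set S :=
  range (fun k => iter k (mul x) x).

Definition gamma_compact (S : topologicalSemigroupType) : Prop :=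
  forall x : S, compact (closure (powers x)).

(* "A `<=` isolated A" says that the subspace A is discrete. *)
Definition countably_compact (X : topologicalType) : Prop :=
  forall A : set X, closed A -> A `<=` isolated A -> finite_set A.

(* By uniform_separatorP, completely_regular_space amounts to the separation of
   points from closed sets by continuous functions to [0, 1]. *)
Definition tychonoff_space (X : topologicalType) : Prop :=
  accessible_space X /\ completely_regular_space X.

Definition pseudocompact (R : realType) (X : topologicalType) : Prop :=
  tychonoff_space X /\
  forall f : X -> R, continuous f -> exists M : R, forall x, (`|f x| <= M)%R.

Definition semigroup_inverse (S : semigroupType) (x y : S) : Prop :=
  (x * y * x)%g = x /\ (y * x * y)%g = y.

Definition topological_inverse_semigroup (S : topologicalSemigroupType) :
    Prop :=
  exists inv : S -> S,
    (forall x y : S, semigroup_inverse x y <-> y = inv x) /\ continuous inv.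

Definition is_subgroup (S : semigroupType) (A : set S) : Prop :=
  (forall x y, A x -> A y -> A (x * y)%g) /\
  exists2 e, A e &
    forall x, A x -> [/\ (e * x)%g = x, (x * e)%g = x &
      exists2 y, A y & (x * y)%g = e /\ (y * x)%g = e].

Definition posint := {k : nat | (0 < k)%N}.

Definition posvec (n : nat) := {ffun 'I_n -> posint}.

Definition lev n (x y : posvec n) : Prop :=
  forall i, (val (x i) <= val (y i))%N.

Definition up n (x : posvec n) : set (posvec n) := [set y | lev x y].

Definition to_zvec n (x : posvec n) : {ffun 'I_n -> int} :=
  [ffun i => Posz (val (x i))].

(* Partial self-maps of posvec n are functions to option; None means
   undefined. *)

Definition pdom n (f : posvec n -> option (posvec n)) : set (posvec n) :=
  [set z | exists w, f z = Some w].

Definition pran n (f : posvec n -> option (posvec n)) : set (posvec n) :=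
  [set w | exists z, f z = Some w].

Definition order_iso_between n (f : posvec n -> option (posvec n))
    (A B : set (posvec n)) : Prop :=
  [/\ pdom f = A, pran f = B &
      forall z z' w w', f z = Some w -> f z' = Some w' ->
        lev z z' <-> lev w w'].

Definition is_ipf n (f : posvec n -> option (posvec n)) : Prop :=
  exists x y, order_iso_between f (up x) (up y).

Record ipf (n : nat) := IPF {
  ipf_fun :> posvec n -> option (posvec n);
  ipfP : is_ipf ipf_fun
}.

Lemma ipf_inj n (a b : ipf n) : ipf_fun a = ipf_fun b -> a = b.
Proof.
case: a b => [f fP] [g gP] /= fg; case: _ / fg in gP *.
by rewrite (Prop_irrelevance fP gP).
Qed.

(* Maps act on the right: z (a b) = (z a) b. *)
Definition pcomp n (f g : posvec n -> option (posvec n)) z := obind g (f z).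

Lemma lev_refl n (x : posvec n) : lev x x. Proof. by []. Qed.

Lemma lev_trans n (y x z : posvec n) : lev x y -> lev y z -> lev x z.
Proof. by move=> xy yz i; apply: leq_trans (yz i). Qed.

Lemma lev_anti n (x y : posvec n) : lev x y -> lev y x -> x = y.
Proof.
move=> xy yx; apply/ffunP => i; apply: val_inj; apply/eqP.
by rewrite eqn_leq xy yx.
Qed.

Definition maxp (a b : posint) : posint := if (val a <= val b)%N then b else a.

Definition maxv n (x y : posvec n) : posvec n := [ffun i => maxp (x i) (y i)].

Lemma lev_max n (x y z : posvec n) :
  lev (maxv x y) z <-> lev x z /\ lev y z.
Proof.
split=> [h|[xz yz] i]; last by rewrite ffunE /maxp; case: ifP.
by split=> i; move: (h i); rewrite ffunE /maxp;
  case: (leqP (val (x i)) (val (y i))) => // c; apply: leq_trans;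
  rewrite // ltnW.
Qed.

Lemma pcomp_ipf n (a b : ipf n) : is_ipf (pcomp a b).
Proof.
have [x [y [da ra oa]]] := ipfP a; have [u [v [db rb ob]]] := ipfP b.
have aD z w : a z = Some w -> lev x z.
  move=> azw; suff: pdom a z by rewrite da; apply.
  by exists w.
have aR z w : a z = Some w -> lev y w.
  move=> azw; suff: pran a w by rewrite ra; apply.
  by exists z.
have bD z w : b z = Some w -> lev u z.
  move=> bzw; suff: pdom b z by rewrite db; apply.
  by exists w.
have bR z w : b z = Some w -> lev v w.
  move=> bzw; suff: pran b w by rewrite rb; apply.
  by exists z.
have ym := ((lev_max y u (maxv y u)).1 (@lev_refl _ _)).
have [x' ax'] : pran a (maxv y u) by rewrite ra; exact: ym.1.
have [v' bv'] : pdom b (maxv y u) by rewrite db; exact: ym.2.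
have am z w : a z = Some w -> lev u w -> lev (maxv y u) w.
  by move=> azw uw; apply/lev_max; split=> //; apply: aR azw.
exists x', v'; split.
- apply/seteqP; split=> [z [t]|z /= x'z].
    rewrite /pcomp; case azw: (a z) => [w|//] /= bwt.
    by apply/(oa _ _ _ _ ax' azw)/(am _ _ azw (bD _ _ bwt)).
  have [w azw] : pdom a z.
    by rewrite da; apply: lev_trans x'z; apply: aD ax'.
  have mw := (oa _ _ _ _ ax' azw).1 x'z.
  have [t bwt] : pdom b w by rewrite db; exact: lev_trans ym.2 mw.
  by exists t; rewrite /pcomp azw.
- apply/seteqP; split=> [t [z]|t /= v't].
    rewrite /pcomp; case azw: (a z) => [w|//] /= bwt.
    by apply/(ob _ _ _ _ bv' bwt)/(am _ _ azw (bD _ _ bwt)).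
  have [w bwt] : pran b t.
    by rewrite rb; apply: lev_trans v't; apply: bR bv'.
  have mw := (ob _ _ _ _ bv' bwt).2 v't.
  have [z azw] : pran a w by rewrite ra; exact: lev_trans ym.1 mw.
  by exists z; rewrite /pcomp azw.
- move=> z z' t t'; rewrite /pcomp.
  case az: (a z) => [w|//] /= bw; case az': (a z') => [w'|//] /= bw'.
  by rewrite (oa _ _ _ _ az az') (ob _ _ _ _ bw bw').
Qed.

Definition ipf_mul n (a b : ipf n) : ipf n := IPF (pcomp_ipf a b).

Lemma ipf_mulA n : associative (@ipf_mul n).
Proof.
move=> a b c; apply: ipf_inj; apply: funext => z /=.
by rewrite /pcomp /=; case: (a z).
Qed.

HB.instance Definition _ n := gen_eqMixin (ipf n).
HB.instance Definition _ n := gen_choiceMixin (ipf n).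
HB.instance Definition _ n := isSemigroup.Build (ipf n) (@ipf_mulA n).

(* The product of 'S_n composes from left to right, so this is a right action. *)
Definition zperm n (z : {ffun 'I_n -> int}) (s : 'S_n) : {ffun 'I_n -> int} :=
  [ffun i => z ((s^-1)%g i)].

Definition perm_zvec (n : nat) : Type := ('S_n * {ffun 'I_n -> int})%type.

Section PermZvec.
Variable n : nat.
Implicit Types (s t : 'S_n) (z w : {ffun 'I_n -> int}) (p q r : perm_zvec n).

Definition perm_zvec_mul p q : perm_zvec n :=
  ((p.1 * q.1)%g, (zperm p.2 q.1 + q.2)%R).

Definition perm_zvec_one : perm_zvec n := (1%g, 0%R).

Definition perm_zvec_inv p : perm_zvec n :=
  ((p.1^-1)%g, (- zperm p.2 (p.1^-1)%g)%R).

Lemma zpermM z s t : zperm z (s * t)%g = zperm (zperm z s) t.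
Proof. by apply/ffunP => i; rewrite !ffunE invMg permM. Qed.

Lemma zperm1 z : zperm z 1%g = z.
Proof. by apply/ffunP => i; rewrite ffunE invg1 perm1. Qed.

Lemma zpermD z w s : zperm (z + w)%R s = (zperm z s + zperm w s)%R.
Proof. by apply/ffunP => i; rewrite !ffunE. Qed.

Lemma zpermN z s : zperm (- z)%R s = (- zperm z s)%R.
Proof. by apply/ffunP => i; rewrite !ffunE. Qed.

Lemma zperm0 s : zperm 0%R s = 0%R.
Proof. by apply/ffunP => i; rewrite !ffunE. Qed.

Lemma perm_zvec_mulA : associative perm_zvec_mul.
Proof.
move=> p q r; congr pair => /=; first by rewrite mulgA.
by rewrite zpermD zpermM GRing.addrA.
Qed.

Lemma perm_zvec_mul1 : left_id perm_zvec_one perm_zvec_mul.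
Proof. by case=> s z; rewrite /perm_zvec_mul mul1g zperm0 GRing.add0r. Qed.

Lemma perm_zvec_1mul : right_id perm_zvec_one perm_zvec_mul.
Proof. by case=> s z; rewrite /perm_zvec_mul mulg1 zperm1 GRing.addr0. Qed.

Lemma perm_zvec_mulV :
  left_inverse perm_zvec_one perm_zvec_inv perm_zvec_mul.
Proof.
case=> s z; rewrite /perm_zvec_mul /= mulVg zpermN -zpermM mulVg zperm1.
by rewrite GRing.addNr.
Qed.

Lemma perm_zvec_Vmul :
  right_inverse perm_zvec_one perm_zvec_inv perm_zvec_mul.
Proof. by case=> s z; rewrite /perm_zvec_mul /= mulgV GRing.subrr. Qed.

HB.instance Definition _ := Choice.on (perm_zvec n).
HB.instance Definition _ := isGroup.Build (perm_zvec n)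
  perm_zvec_mulA perm_zvec_mul1 perm_zvec_1mul perm_zvec_mulV perm_zvec_Vmul.

End PermZvec.

Section Upsilon.
Variable n : nat.
Implicit Type a : ipf n.

Definition ipf_x a : posvec n := sval (cid (ipfP a)).

Definition ipf_y a : posvec n := sval (cid (svalP (cid (ipfP a)))).

Lemma ipf_xyP a : order_iso_between a (up (ipf_x a)) (up (ipf_y a)).
Proof. exact: svalP (cid (svalP (cid (ipfP a)))). Qed.

Definition zone : {ffun 'I_n -> int} := [ffun=> 1%R].

Definition is_ipf_perm a (s : 'S_n) : Prop :=
  forall z w, a z = Some w ->
    to_zvec w = (zperm (to_zvec z - to_zvec (ipf_x a) + zone) s
                 + to_zvec (ipf_y a) - zone)%R.

(* Exactly one s satisfies is_ipf_perm a, so that the default value 1 of xget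
   is irrelevant. *)
Definition ipf_perm a : 'S_n := xget 1%g [set s | is_ipf_perm a s].

Definition Upsilon a : perm_zvec n :=
  (ipf_perm a,
   (zperm (to_zvec (ipf_x a)) (ipf_perm a) - to_zvec (ipf_y a))%R).

End Upsilon.

(* Main.v *)
Require Import Defs.
From HB Require Import structures.
From mathcomp Require Import all_boot all_order all_algebra all_fingroup.
From mathcomp Require Import all_classical all_reals all_analysis.
From mathcomp Require Import lra zify.
Import Order.TTheory GRing.Theory Num.Theory.
Import numFieldNormedType.Exports.

Set Implicit Arguments.
Unset Strict Implicit.
Unset Printing Implicit Defensive.

Local Open Scope classical_set_scope.

(* For each x, the isomorphism p from N^n onto the filter of x and its inverse
   q satisfy p q = 1, and q p is the identity e_x of the filter of x.
   Everything reduces to showing h(q p) = h(p q), that is h(e_x) = h(1): then h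
   identifies all idempotents, hence any two maps that agree on a common filter,
   and these are exactly the maps with the same image under Upsilon.

   So let p q = 1 in S, with 1 a unit for p and q, and put e = q p.
   If the sequence (p^k, q^k) has a cluster point (P, Q) in S x S, then P Q = 1,
   because p^k q^k = 1; but (P, Q) also adheres to the pairs (p^k, q^j) with
   j < k, whose products p^(k-j) are fixed by right multiplication by e.  Hence
   1 e = 1, i.e. e = 1.  Conditions (i)-(iv) provide such a cluster point.

   If S x S is pseudocompact and e <> 1, choose d continuous on S with
   d(e) - d(1) = 1 and let F(x, y) = d(x y e) - d(x y).  Then F(p^j, q^j) = 1,
   and F(p^k, q^j) = 0 for j < k, so the functions F(p^k, .) are uniformly
   separated.  But pseudocompactness of S x S makes x |-> F(x, .) continuous for
   the uniform norm, and excludes uniformly separated sequences in its image. *)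

(** * Cluster points in Hausdorff and countably compact spaces *)

Lemma closure_eqfun (X Y : topologicalType) (f g : X -> Y) (A : set X) (z : X) :
  hausdorff_space Y -> continuous f -> continuous g ->
  closure A z -> {in A, f =1 g} -> f z = g z.
Proof.
move=> hY cf cg Az fg; apply: hY => U V Uz Vz.
have zU : nbhs z (f @^-1` U) by exact: cf.
have zV : nbhs z (g @^-1` V) by exact: cg.
have [x [Ax [Ux Vx]]] := Az _ (filterI zU zV).
by exists (f x); split=> //; rewrite fg ?inE.
Qed.

(** Without a cluster point the range of [u] would be closed and discrete, hence finite, hence
    compact; but a sequence in a compact set has a cluster point. *)
Lemma countably_compact_cluster (X : topologicalType) (u : nat -> X) :
  hausdorff_space X -> countably_compact X -> cluster (u @ \oo) !=set0.
Proof.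
move=> hX cX; apply/not_existsP => nocl.
have sep (x : X) :
    exists2 V, nbhs x V & exists N, forall k, (N <= k)%N -> ~ V (u k).
  have /existsNP[B /existsNP[V /not_implyP[[N _ BN]]]] := nocl x.
  move=> /not_implyP[xV BV].
  exists V => //; exists N => k Nk Vk; apply: BV; exists (u k); split => //.
  exact: BN.
have X1 := hausdorff_accessible hX.
(* Only finitely many values of u come near x, so a smaller neighbourhood
   avoids those that differ from x. *)
have iso (x : X) : exists2 V, nbhs x V & V `&` range u `<=` [set x].
  have [V xV [N VN]] := sep x.
  pose F := (u @` `I_N) `\ x.
  have cF : closed F.
    apply: (accessible_finite_set_closed.1 X1).
    by apply: finite_setD; apply: finite_image; exact: finite_II.
  exists (V `&` ~` F).
    apply: filterI => //; apply: open_nbhs_nbhs.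
    split; first exact: closed_openC.
    by case=> _; apply.
  move=> y [[Vk Fk] [k _ uk]]; rewrite -{}uk in Vk Fk *.
  apply: contrapT => kx; apply: Fk; split => //; exists k => //=.
  by rewrite ltnNge; apply/negP => /VN; exact.
have finu : finite_set (range u).
  apply: cX.
    move=> x clx; have [V xV Vx] := iso x.
    have [y [uy Vy]] := clx _ xV.
    by have <- : y = x by exact: Vx.
  move=> _ [k _ <-]; split; first by rewrite inE; exists k.
  have [V xV Vx] := iso (u k); exists V => //.
  apply/seteqP; split => // _ ->; split; last by exists k.
  exact: nbhs_singleton.
have cu : compact (range u) by exact: finite_compact.
have [] := cu (u @ \oo) _ _; last by move=> x [_ /nocl].
by exists 0 => // k _ /=; exists k.
Qed.

(** * Relations between the powers of [p] and of [q] *)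

Section Powers.
Variable S : semigroupType.
Implicit Types (x : S) (k j : nat).
Local Open Scope group_scope.

(* As in the definition of powers, the exponents are shifted: spow x k is
   x^(k+1). *)
Definition spow x k : S := iter k (mul x) x.

Lemma spowS x k : spow x k.+1 = x * spow x k. Proof. by []. Qed.

Lemma spowSr x k : spow x k.+1 = spow x k * x.
Proof. by elim: k => // k IH; rewrite spowS {1}IH mulgA. Qed.

Lemma spowD x k j : spow x (k + j.+1) = spow x k * spow x j.
Proof.
elim: j => [|j IH]; first by rewrite addn1 spowSr.
by rewrite addnS spowSr IH spowSr mulgA.
Qed.

Variables p q : S.
Hypotheses (ppq : p * (p * q) = p) (pqp : p * (q * p) = p).

Lemma spow_mulV k : spow p k * spow q k = p * q.
Proof.
elim: k => // k IH.
by rewrite spowS spowSr mulgA -(mulgA p) IH ppq.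
Qed.

(** The surplus of factors [p] leaves at least one of them to absorb the [p * q] produced by
    [spow_mulV]. In unshifted exponents, p^(k+j+2) q^(j+1) = p^(k+1). *)
Lemma spow_mul_lt k j : spow p (k + j.+1) * spow q j = spow p k.
Proof.
rewrite spowD -mulgA spow_mulV.
by case: k => // k; rewrite spowSr -mulgA ppq.
Qed.

Lemma spow_idem k : spow p k * (q * p) = spow p k.
Proof. by case: k => // k; rewrite spowSr -mulgA pqp. Qed.

End Powers.
Arguments spow {S}.

(** * Collapse from a cluster point of the pairs of powers *)

Section Cluster.
Variables (S : topologicalSemigroupType) (p q : S).
Local Open Scope group_scope.
Hypotheses (ppq : p * (p * q) = p) (pqp : p * (q * p) = p).
Hypothesis pqq : p * q * q = q.

Lemma mulr_continuous (a : S) : continuous (fun x : S => x * a).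
Proof.
move=> x; apply: (@continuous_comp _ _ _ (fun x : S => (x, a))
  (fun z : S * S => z.1 * z.2)); last exact: mulg_continuous.
by apply: cvg_pair => /=; [exact: cvg_id | exact: cvg_cst].
Qed.

(** [S] need not have a unit: [p * q] replaces it, being a right unit for [p] and a left unit for
    [q], so that e = 1 becomes [q * p = p * q]. *)
Lemma bicyclic_cluster :
  hausdorff_space S ->
  cluster ((fun k => (spow p k, spow q k)) @ \oo) !=set0 -> q * p = p * q.
Proof.
move=> hS [[P Q] clPQ].
have PQ : P * Q = p * q.
  apply: (@closure_eqfun _ _ (fun z : S * S => z.1 * z.2) (fun=> p * q)
    (range (fun k => (spow p k, spow q k))) (P, Q)) => //.
  - exact: mulg_continuous.
  - by move=> ?; exact: cvg_cst.
  - by move=> V PQV; apply: (clPQ) => //; exists 0 => // k _ /=; exists k.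
  - by move=> _ /[!inE] -[k _ <-] /=; exact: spow_mulV.
(* A single neighbourhood U x V of (P, Q) contains both (p^j, q^j) and
   (p^k, q^k) for some k > j, hence (p^k, q^j). *)
have cllt : closure
    [set z : S * S | exists k j, z = (spow p (k + j.+1), spow q j)] (P, Q).
  move=> W [[U V] /= [UP VQ] UVW].
  have oft N : exists2 k, (N <= k)%N & U (spow p k) /\ V (spow q k).
    have [] := clPQ [set z | exists2 k, (N <= k)%N & z = (spow p k, spow q k)]
      (U `*` V).
    - by exists N => // k Nk; exists k.
    - by exists (U, V).
    - by move=> z [[k Nk ->] [Uk Vk]]; exists k.
  have [j _ [_ Vj]] := oft 0; have [k jk [Uk _]] := oft j.+1.
  exists (spow p k, spow q j); split; last by apply: UVW; split.
  by exists (k - j.+1), j; rewrite subnK.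
have : P * Q * (q * p) = P * Q.
  apply: (@closure_eqfun _ _ (fun z : S * S => z.1 * z.2 * (q * p))
    (fun z : S * S => z.1 * z.2) _ _ _ _ _ cllt) => //.
  - move=> z; apply: (@continuous_comp _ _ _ (fun z : S * S => z.1 * z.2)
      (fun x : S => x * (q * p))); first exact: mulg_continuous.
    exact: mulr_continuous.
  - exact: mulg_continuous.
  - move=> z /[!inE] -[k [j ->]] /=; rewrite spow_mul_lt//.
    by rewrite spow_idem.
(* Reassociated, the left side is [p * q * q * p], which [pqq] turns into [q * p]. *)
by rewrite PQ mulgA pqq.
Qed.

End Cluster.

(** * Pseudocompact spaces and products *)

Lemma open_setX (X Y : topologicalType) (A : set X) (B : set Y) :
  open A -> open B -> open (A `*` B).
Proof.
move=> oA oB; rewrite openE => -[x y] [/= Ax By].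
by exists (A, B) => //; split; apply: open_nbhs_nbhs.
Qed.

Definition discrete_family (X : topologicalType) (O : nat -> set X) :=
  forall x : X, exists2 N, nbhs x N &
    forall i j, N `&` O i !=set0 -> N `&` O j !=set0 -> i = j.

(** Take bump functions [g n] that vanish off [O n] and reach 1 on it. The sum of the [n * g n] is
    locally a single term, hence continuous, and it is unbounded. *)
Lemma pseudocompact_discrete_family (R : realType) (X : topologicalType)
    (O : nat -> set X) :
  pseudocompact R X -> (forall n, open (O n)) -> (forall n, O n !=set0) ->
  ~ discrete_family O.
Proof.
move=> [[_ crX] bndX] oO O0 dO.
have bump n : {g : X -> R | [/\ continuous g, forall x, ~ O n x -> g x = 0%R
    & exists2 x, O n x & g x = 1%R]}.
  apply: cid; have [x Ox] := O0 n.
  have cO : closed (~` O n) by exact: open_closedC.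
  have /uniform_separatorP-/(_ R)[f [cf _ f0 f1]] := crX x _ cO (fun h => h Ox).
  exists (fun y => 1 - f y)%R; split.
  - by move=> y; apply: cvgB; [exact: cvg_cst | exact: cf].
  - move=> y Oy; have -> : f y = 1%R by apply: f1; exists y.
    by rewrite subrr.
  - exists x => //; have fx : f x = 0%R by apply: f0; exists x.
    by rewrite fx subr0.
pose g n := sval (bump n).
(* At most one term of the sum is nonzero at [x], so the sum is written as that term; the default
   index 0 gives the value 0 off all the [O n]. *)
pose idx x := xget 0%N [set n | O n x].
pose f x := ((idx x)%:R * g (idx x) x)%R.
have fE n x N : (forall i j, N `&` O i !=set0 -> N `&` O j !=set0 -> i = j) ->
    N `&` O n !=set0 -> N x -> f x = (n%:R * g n x)%R.
  move=> NO On Nx; rewrite /f /idx; case: xgetP => [m _ Om|no].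
    by rewrite (NO m n) //; exists x.
  have [_ g0 _] := svalP (bump n).
  by rewrite mul0r /g (g0 _ (no n)) mulr0.
have cf : continuous f.
  move=> x; have [N xN NO] := dO x.
  have [[n On]|no] := pselect (exists n, N `&` O n !=set0).
    suff : {for x, continuous (fun y => n%:R * g n y)%R}.
      rewrite /prop_for /continuous_at -(fE n x N)//;
        last exact: nbhs_singleton.
      apply: cvg_trans; apply: near_eq_cvg.
      by apply: filterS xN => y Ny; rewrite (fE n y N).
    have [cg _ _] := svalP (bump n).
    by apply: cvgM; [exact: cvg_cst | exact: cg].
  have f0 y : N y -> f y = 0%R.
    move=> Ny; rewrite /f /idx.
    case: xgetP => [m _ Om|_]; last by rewrite mul0r.
    by exfalso; apply: no; exists m, y.
  rewrite /prop_for /continuous_at f0; last exact: nbhs_singleton.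
  suff : ((fun=> 0%R : R) y @[y --> x] --> (0%R : R)).
    apply: cvg_trans; apply: near_eq_cvg.
    by apply: filterS xN => y Ny; rewrite f0.
  exact: cvg_cst.
have [M fM] := bndX f cf.
have [n nM] : exists n, (M < n%:R)%R.
  exists (Num.truncn M).+1; exact: truncnS_gt.
have [_ _ [x Ox gx]] := svalP (bump n).
have [N xN NO] := dO x.
have := fM x; rewrite (fE n x N) //; last exact: nbhs_singleton.
  by rewrite /g gx mulr1 normr_nat leNgt nM.
by exists x; split => //; exact: nbhs_singleton.
Qed.

(** Otherwise one can build inductively a discrete family of nonempty open boxes on which [F] stays
    away from its values over [x0], against [pseudocompact_discrete_family]. *)
Lemma pseudocompact_equicontinuous (R : realType) (X Y : topologicalType)
    (F : X * Y -> R) (x0 : X) (e : R) :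
  pseudocompact R (X * Y)%type -> continuous F -> (0 < e)%R ->
  exists2 N, nbhs x0 N & forall x y, N x -> (`|F (x, y) - F (x0, y)| <= e)%R.
Proof.
move=> pXY cF e0; apply: contrapT => noN.
pose H z : R := `|F z - F (x0, z.2)|%R.
have cH : continuous H.
  move=> z; apply: cvg_norm; apply: cvgB; first exact: cF.
  apply: (@continuous_comp _ _ _ (fun z : X * Y => (x0, z.2)) F);
    last exact: cF.
  by apply: cvg_pair => /=; [exact: cvg_cst | exact: cvg_snd].
have nH z (d : R) : (0 < d)%R -> nbhs z [set t | (`|H z - H t| < d)%R].
  by move=> d0; move/cvgrPdist_lt : (cH z) => /(_ _ d0).
(* If H exceeds e on points arbitrarily close to {x0} x Y, there are boxes
   U_n x V_n where H > e and neighbourhoods W_n of x0 such that H < e / 2 on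
   W_n x V_n and U_m is included in W_n for m > n.  Two boxes cannot meet a set
   A x B where H varies by less than e / 2: if x' is in A and U_m, and (x, y) is
   in A x B and U_n x V_n, then H(x', y) < e / 2 < e < H(x, y).  A stage of the
   construction is a triple (U, V, W). *)
pose st := (set X * set Y * set X)%type.
pose good (t : st) :=
  [/\ open t.1.1, open t.1.2, t.1.1 !=set0 & t.1.2 !=set0] /\
  [/\ open t.2, t.2 x0, forall x y, t.1.1 x -> t.1.2 y -> (e < H (x, y))%R
  & forall x y, t.2 x -> t.1.2 y -> (H (x, y) < e / 2)%R].
have step W : open W -> W x0 ->
    exists t : st, [/\ good t, t.1.1 `<=` W & t.2 `<=` W].
  move=> oW Wx0.
  have [x [y [Wx xy]]] : exists x y, W x /\ (e < H (x, y))%R.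
    apply: contrapT => no; apply: noN; exists W; first exact: open_nbhs_nbhs.
    by move=> x y Wx; rewrite leNgt; apply/negP => ?; apply: no; exists x, y.
  have [[U V] /= [xU yV] UV] : nbhs (x, y) [set t | (e < H t)%R].
    have d0 : (0 < H (x, y) - e)%R by rewrite subr_gt0.
    apply: filterS (nH (x, y) _ d0) => t /=.
    by rewrite ltr_norml => /andP[]; lra.
  have [[W' V'] /= [xW' yV'] WV'] : nbhs (x0, y) [set t | (H t < e / 2)%R].
    have d0 : (0 < e / 2)%R by lra.
    apply: filterS (nH (x0, y) _ d0) => t /=.
    by rewrite ltr_norml => /andP[]; rewrite [H (x0, y)]/H /= subrr normr0; lra.
  exists ((U° `&` W), (V° `&` V'°), (W'° `&` W)); split=> //=.
  - split; split => //=.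
    + by apply: openI => //; exact: open_interior.
    + by apply: openI; exact: open_interior.
    + by exists x.
    + by exists y.
    + by apply: openI => //; exact: open_interior.
    + move=> a b [/interior_subset Ua _] [/interior_subset Vb _].
      exact: (UV (a, b)).
    + move=> a b [/interior_subset Ua _] [_ /interior_subset Vb].
      exact: (WV' (a, b)).
have [t0 [gt0 _ _]] := step setT openT I.
pose T := {t : st | good t}.
pose next (s t : T) :=
  (sval t).1.1 `<=` (sval s).2 /\ (sval t).2 `<=` (sval s).2.
have nextP (s : T) : {t : T | next s t}.
  apply: cid; case: s => s [s1 [s2 s3 s4 s5]] /=.
  by have [t [gt tU tW]] := step _ s2 s3; exists (exist _ t gt).
have [f [_ fS]] := dependent_choice nextP (exist _ t0 gt0).
pose U n := (sval (f n)).1.1; pose V n := (sval (f n)).1.2.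
pose W n := (sval (f n)).2.
have UW i j : (i < j)%N -> U j `<=` W i.
  have WW k : W (i + k)%N `<=` W i.
    elim: k => [|k IH]; first by rewrite addn0.
    by rewrite addnS; apply: subset_trans IH; exact: (fS _).2.
  move=> ij; rewrite -(subnK ij) addnS addnC.
  by apply: subset_trans (WW _); exact: (fS _).1.
pose O n := U n `*` V n.
apply: (@pseudocompact_discrete_family R _ O pXY).
- move=> n; have [[oU oV _ _] _] := svalP (f n).
  by apply: open_setX.
- move=> n; have [[_ _ [x Ux] [y Vy]] _] := svalP (f n).
  by exists (x, y).
move=> [P Q].
(* With [e / 4] around [(P, Q)], two values of [H] on the box differ by less than [e / 2]. *)
have d0 : (0 < e / 4)%R by lra.
have [[A B] /= [PA QB] AB] := nH (P, Q) _ d0.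
exists (A `*` B); first by exists (A, B).
have lt i j : (i < j)%N ->
    A `*` B `&` O i !=set0 -> A `*` B `&` O j !=set0 -> False.
  move=> ij [[x y] [[/= Ax By] [/= Ux Vy]]].
  move=> [[x' y'] [[/= Ax' By'] [/= Ux' Vy']]].
  have [_ [_ _ HU HW]] := svalP (f i).
  have := AB (x, y) (conj Ax By); have := AB (x', y) (conj Ax' By) => /=.
  have := HU _ _ Ux Vy; have := HW x' y (UW _ _ ij _ Ux') Vy.
  by move=> ? ? /ltr_normlP[? ?] /ltr_normlP[? ?]; lra.
move=> i j Oi Oj; case: (ltngtP i j) => // ij; exfalso.
  exact: lt ij Oi Oj.
exact: lt ij Oj Oi.
Qed.

(** By equicontinuity each [x] has a neighbourhood [N x] where all [F (., y)] vary by at most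
    [|c| / 4]. If [N P] met both [N (a j)] and [N (a k)] with [j < k], three such variations would
    lead from [F (a j, b j) = c] to [F (a k, b j) = 0]. So the strips over the [N (a n)] form a
    discrete family. *)
Lemma pseudocompact_separated (R : realType) (X Y : topologicalType)
    (F : X * Y -> R) (a : nat -> X) (b : nat -> Y) (c : R) :
  pseudocompact R (X * Y)%type -> continuous F -> c != 0%R ->
  (forall j, F (a j, b j) = c) ->
  (forall j k, (j < k)%N -> F (a k, b j) = 0%R) -> False.
Proof.
move=> pXY cF c0 Fc F0.
have d0 : (0 < `|c| / 8)%R by rewrite divr_gt0// normr_gt0.
have eq (x : X) : {N : set X | nbhs x N &
    forall x' y, N x' -> (`|F (x', y) - F (x, y)| <= `|c| / 8)%R}.
  by apply: cid2; exact: pseudocompact_equicontinuous.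
have {}eq (x : X) : {N : set X | nbhs x N &
  forall x' x'' y, N x' -> N x'' -> (`|F (x', y) - F (x'', y)| <= `|c| / 4)%R}.
  have [N xN NF] := eq x; exists N => // x' x'' y Nx' Nx''.
  have := NF _ y Nx'; have := NF _ y Nx''.
  by rewrite !ler_norml => /andP[? ?] /andP[? ?]; lra.
pose N x := s2val (eq x).
have NF x : forall x' x'' y, N x x' -> N x x'' ->
  (`|F (x', y) - F (x'', y)| <= `|c| / 4)%R by exact: (s2valP' (eq x)).
have xN (x : X) : nbhs x (N x) by exact: (s2valP (eq x)).
pose O n := (N (a n))° `*` [set: Y].
apply: (@pseudocompact_discrete_family R _ O pXY).
- by move=> n; apply: open_setX; [exact: open_interior|exact: openT].
- by move=> n; exists (a n, b n); split; [exact: xN|].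
move=> [P Q].
exists (N P `*` setT).
  by exists (N P, setT) => //; split=> //; exact: filterT.
have lt j k : (j < k)%N -> N P `*` setT `&` O j !=set0 ->
    N P `*` setT `&` O k !=set0 -> False.
  move=> jk [[x y] [[/= Nx _] [/= /interior_subset Nj _]]].
  move=> [[x' y'] [[/= Nx' _] [/= /interior_subset Nk _]]].
  have := NF _ _ _ (b j) Nx Nx'.
  have := NF _ _ _ (b j) Nj (nbhs_singleton (xN (a j))).
  have := NF _ _ _ (b j) Nk (nbhs_singleton (xN (a k))).
  rewrite Fc F0// => h1 h2 h3.
  have : (0 < `|c|)%R by rewrite normr_gt0.
  move: h1 h2 h3; rewrite !ler_norml.
  case: (ger0P c) => _ => /andP[? ?] /andP[? ?] /andP[? ?] ?; lra.
move=> i j Oi Oj; case: (ltngtP i j) => // ij; exfalso.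
  exact: lt ij Oi Oj.
exact: lt ij Oj Oi.
Qed.

(** * Collapse when the square is pseudocompact *)

Section Collapse.
Variables (S : topologicalSemigroupType) (p q : S).
Local Open Scope group_scope.
Hypotheses (ppq : p * (p * q) = p) (pqp : p * (q * p) = p).
Hypothesis pqq : p * q * q = q.

Lemma bicyclic_pseudocompact (R : realType) :
  pseudocompact R (S * S)%type -> q * p = p * q.
Proof.
move=> pS; apply: contrapT => npq.
have [[acc cr] _] := pS.
(* Complete regularity is given for the square, so the two points are separated on its diagonal, and
   [d] is the restriction of [f] to the diagonal. *)
have cl : closed [set ((q * p, q * p) : S * S)].
  exact: accessible_closed_set1.
have nel : ~ [set ((q * p, q * p) : S * S)] (p * q, p * q) by case=> /esym.
have /uniform_separatorP-/(_ R)[f [cf _ f0 f1]] := cr _ _ cl nel.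
have {}f0 : f (p * q, p * q) = 0%R by apply: f0; exists (p * q, p * q).
have {}f1 : f (q * p, q * p) = 1%R by apply: f1; exists (q * p, q * p).
pose d (x : S) : R := f (x, x).
have cd : continuous d.
  move=> x; apply: (@continuous_comp _ _ _ (fun x : S => (x, x)) f);
    last exact: cf.
  by apply: cvg_pair; exact: cvg_id.
pose F (z : S * S) : R := (d (z.1 * z.2 * (q * p))%g - d (z.1 * z.2)%g)%R.
have cF : continuous F.
  have cm : continuous (fun z : S * S => d (z.1 * z.2)).
    move=> z; apply: (@continuous_comp _ _ _ (fun z : S * S => z.1 * z.2) d);
      first exact: mulg_continuous.
    exact: cd.
  move=> z; apply: cvgB; last exact: cm.
  apply: (@continuous_comp _ _ _ (fun z : S * S => z.1 * z.2)
    (fun x : S => d (x * (q * p)))); first exact: mulg_continuous.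
  apply: (@continuous_comp _ _ _ (fun x : S => x * (q * p)) d); last exact: cd.
  exact: mulr_continuous.
apply: (@pseudocompact_separated R _ _ F (spow p) (spow q) 1%R) => //.
- by move=> j; rewrite /F /= spow_mulV// [_ * (q * p)]mulgA pqq /d f1 f0 subr0.
- move=> j k jk; rewrite /F /= -(subnK jk) spow_mul_lt// spow_idem//.
  by rewrite subrr.
Qed.

End Collapse.

(** * Cluster points from the other conditions, and the collapse in all cases *)

Lemma gamma_compact_cluster (S : topologicalSemigroupType) (p q : S) :
  gamma_compact S -> cluster ((fun k => (spow p k, spow q k)) @ \oo) !=set0.
Proof.
move=> cS; have cK := compact_setX (cS p) (cS q).
have [] := cK ((fun k => (spow p k, spow q k)) @ \oo) _ _.
  by exists 0%N => // k _; split; apply: subset_closure; exists k.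
by move=> x [_ ?]; exists x.
Qed.

Lemma compact_gamma_compact (S : topologicalSemigroupType) :
  compact [set: S] -> gamma_compact S.
Proof.
move=> cS x; apply: subclosed_compact cS _ => //; exact: closed_closure.
Qed.

Lemma hausdorff_prod (X Y : topologicalType) :
  hausdorff_space X -> hausdorff_space Y -> hausdorff_space (X * Y)%type.
Proof.
move=> hX hY [x y] [x' y'] cl; congr pair.
- apply: hX => A B xA xB.
  have [|| [u v] [[/= ? _] [/= ? _]]] := cl (A `*` setT) (B `*` setT).
  + by exists (A, setT) => //; split => //; exact: filterT.
  + by exists (B, setT) => //; split => //; exact: filterT.
  + by exists u.
- apply: hY => A B xA xB.
  have [|| [u v] [[/= _ ?] [/= _ ?]]] := cl (setT `*` A) (setT `*` B).
  + by exists (setT, A) => //; split => //; exact: filterT.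
  + by exists (setT, B) => //; split => //; exact: filterT.
  + by exists v.
Qed.

(** Here [spow q k] is the inverse of [spow p k], so a cluster point [P] of the powers of [p] alone
    yields the cluster point [(P, inv P)] of the pairs, by continuity of [inv]. *)
Lemma inverse_cluster (S : topologicalSemigroupType) (p q : S) :
  hausdorff_space S -> countably_compact S -> topological_inverse_semigroup S ->
  (p * (p * q) = p -> p * (q * p) = p -> q * (p * q) = q ->
  cluster ((fun k => (spow p k, spow q k)) @ \oo) !=set0)%g.
Proof.
move=> hS cS [inv [invP cinv]] ppq pqp qpq.
have qk k : spow q k = inv (spow p k).
  apply/invP; split.
    rewrite spow_mulV//.
    by case: k => [|k]; rewrite ?spowS 1?mulgA -(mulgA p) pqp.
  by rewrite -mulgA spow_mulV//; case: k => // k; rewrite spowSr -mulgA qpq.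
have [P clP] := countably_compact_cluster (spow p) hS cS.
exists (P, inv P) => A B AP [[U V] /= [PU PV] UV].
have PV' : nbhs P (inv @^-1` V) by exact: cinv.
have FA : (spow p @ \oo) (spow p @` [set k | A (spow p k, spow q k)]).
  have {}AP : \forall k \near \oo, A (spow p k, spow q k) by exact: AP.
  by apply: filterS AP => k Ak; exists k.
have [x [[k Ax xk] [Ux Vx]]] := clP _ _ FA (filterI PU PV').
rewrite -{}xk in Ux Vx.
exists (spow p k, spow q k); split => //.
by apply: UV; split => //=; rewrite qk.
Qed.

Lemma bicyclic_collapse (R : realType) (S : topologicalSemigroupType)
    (p q : S) :
  hausdorff_space S ->
  compact [set: S]
    \/ gamma_compact S
    \/ (countably_compact S /\ topological_inverse_semigroup S)
    \/ countably_compact (S * S)%type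
    \/ pseudocompact R (S * S)%type ->
  (p * (p * q) = p -> p * (q * p) = p -> p * q * q = q -> q * (p * q) = q ->
  q * p = p * q)%g.
Proof.
move=> hS + ppq pqp pqq qpq.
move=> [/compact_gamma_compact cS|[cS|[[cS iS]|[cS|pS]]]].
- by apply: bicyclic_cluster => //; exact: gamma_compact_cluster.
- by apply: bicyclic_cluster => //; exact: gamma_compact_cluster.
- by apply: bicyclic_cluster => //; exact: inverse_cluster.
- apply: bicyclic_cluster => //; apply: countably_compact_cluster => //.
  exact: hausdorff_prod.
- exact: bicyclic_pseudocompact pS.
Qed.

(** * Order automorphisms of tuples of natural numbers *)

Lemma homo_leq_can_id (f g : nat -> nat) :
  {homo f : i j / (i <= j)%N} -> {homo g : i j / (i <= j)%N} ->
  cancel f g -> cancel g f -> f =1 id.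
Proof.
(* A monotone injection of [nat] never falls below the identity; this is applied to [f] and to its
   inverse. *)
have le_id (h h' : nat -> nat) :
    {homo h : i j / (i <= j)%N} -> cancel h h' -> forall k, (k <= h k)%N.
  move=> hm hK; elim=> // k IH; apply: leq_ltn_trans IH _.
  rewrite ltn_neqAle hm// andbT; apply/eqP => /(can_inj hK); lia.
move=> fm gm fK gK k; apply/eqP; rewrite eqn_leq (le_id f g)// andbT.
by rewrite -[leqRHS]fK (le_id g f).
Qed.

Section OrderAutomorphisms.
Variable n : nat.
Local Notation vec := {ffun 'I_n -> nat}.
Implicit Types (v w : vec) (i j : 'I_n) (k : nat).

Definition levec v w := forall i, (v i <= w i)%N.

Definition axis k i : vec := [ffun j => if j == i then k else 0%N].

Lemma levec_anti v w : levec v w -> levec w v -> v = w.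
Proof. by move=> vw wv; apply/ffunP => i; apply/eqP; rewrite eqn_leq vw wv. Qed.

Lemma levec_axis k i v : levec (axis k i) v <-> (k <= v i)%N.
Proof.
split=> [/(_ i)|kv j]; first by rewrite ffunE eqxx.
by rewrite ffunE; case: eqP => // ->.
Qed.

Lemma axisE k i : axis k i i = k. Proof. by rewrite ffunE eqxx. Qed.

Lemma axis_ge1 k i j : (1 <= axis k i j)%N -> j = i.
Proof. by rewrite ffunE; case: eqP. Qed.

Lemma axis_eta v i : (forall j, (1 <= v j)%N -> j = i) -> v = axis (v i) i.
Proof.
move=> h; apply/ffunP => j; rewrite ffunE; case: eqP => [-> //|ji].
by case: (posnP (v j)) => // /h.
Qed.

(** An automorphism fixes the least vector, hence permutes the atoms [axis 1 i]. The vectors above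
    no atom but [axis 1 i] are the [axis k i], so each axis is mapped onto an axis, and a chain like
    [nat] has only the trivial automorphism. Finally, the axis vectors below [v] determine [v]. *)
Lemma order_automorphism_perm (f g : vec -> vec) :
  cancel f g -> cancel g f ->
  (forall v w, levec v w <-> levec (f v) (f w)) ->
  exists s : 'S_n, forall v i, f v (s i) = v i.
Proof.
move=> fK gK fle.
have gle v w : levec v w <-> levec (g v) (g w).
  by rewrite [levec (g v) _]fle !gK.
have f0 : f [ffun=> 0%N] = [ffun=> 0%N].
  apply: levec_anti => [|i]; last by rewrite ffunE.
  have : levec (f [ffun=> 0%N]) (f (g [ffun=> 0%N])).
    by rewrite -fle => i; rewrite ffunE.
  by rewrite gK.
have atom i : exists j, f (axis 1 i) = axis 1 j.
  have [j fj] : exists j, (1 <= f (axis 1 i) j)%N.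
    apply: contrapT => no; suff : axis 1 i = [ffun=> 0%N].
      by move/ffunP => /(_ i); rewrite axisE ffunE.
    rewrite -[LHS]fK -[RHS]fK f0; congr (g _); apply/ffunP => j.
    rewrite [RHS]ffunE; case: (posnP (f (axis 1 i) j)) => // ?.
    by case: no; exists j.
  (* The preimage of [axis 1 j] lies below the atom [axis 1 i], and it is not zero because [f] fixes
     zero; so it equals that atom. *)
  exists j; apply: levec_anti; last exact/levec_axis.
  rewrite -[axis 1 j]gK -fle; apply/levec_axis.
  rewrite lt0n; apply/eqP => g0.
  have gj : levec (g (axis 1 j)) (axis 1 i) by rewrite fle gK; exact/levec_axis.
  have : g (axis 1 j) = [ffun=> 0%N].
    apply/ffunP => l; rewrite ffunE; have := gj l; rewrite ffunE.
    by case: eqP => [->|_]; [rewrite g0 | rewrite leqn0 => /eqP].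
  by move/(congr1 f); rewrite gK f0 => /ffunP/(_ j); rewrite axisE ffunE.
have [s0 s0P] := choice atom.
have s0_inj : injective s0.
  move=> i j ij; have := s0P i; rewrite ij -s0P => /(can_inj fK)/ffunP/(_ i).
  by rewrite axisE => ai; apply: (@axis_ge1 1); rewrite -ai.
pose s := perm s0_inj; exists s => v i.
have sP j : f (axis 1 j) = axis 1 (s j) by rewrite permE.
have f_axis k : f (axis k i) = axis (f (axis k i) (s i)) (s i).
  apply: axis_eta => j; rewrite -{1 2}[j](permKV s) => /levec_axis.
  by rewrite -sP -fle => /levec_axis /axis_ge1 ->.
have g_axis k : g (axis k (s i)) = axis (g (axis k (s i)) i) i.
  apply: axis_eta => j /levec_axis; rewrite fle gK sP => /levec_axis /axis_ge1.
  exact: perm_inj.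
have axis_le k k' j : levec (axis k j) (axis k' j) <-> (k <= k')%N.
  by rewrite levec_axis axisE.
have f_id : (fun k => f (axis k i) (s i)) =1 id.
  apply: (@homo_leq_can_id _ (fun k => g (axis k (s i)) i)).
  - move=> k k' kk'; apply/(axis_le _ _ (s i)).
    by rewrite -!f_axis -fle axis_le.
  - by move=> k k' kk'; apply/(axis_le _ _ i); rewrite -!g_axis -gle axis_le.
  - by move=> k /=; rewrite -f_axis fK axisE.
  - by move=> k /=; rewrite -g_axis gK axisE.
have fvE k : (k <= v i)%N = (k <= f v (s i))%N.
  have kv : levec (axis k i) v <-> levec (axis k (s i)) (f v).
    by have /= fk := f_id k; rewrite fle f_axis fk.
  by apply/idP/idP => /levec_axis/kv/levec_axis.
by apply/eqP; rewrite eqn_leq -fvE leqnn fvE leqnn.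
Qed.

End OrderAutomorphisms.

(** * Isomorphisms between principal filters and their images under [Upsilon] *)

Section Ipf.
Variable n : nat.
Implicit Types (x y z w : posvec n) (v : {ffun 'I_n -> nat}) (s t : 'S_n).
Implicit Types (a b : ipf n).

Lemma posvec_addn_gt0 x v i : (0 < val (x i) + v i)%N.
Proof. by rewrite ltn_addr// (valP (x i)). Qed.

Definition posvec_addn x v : posvec n :=
  [ffun i => exist (fun k => is_true (0 < k)%N) _ (posvec_addn_gt0 x v i)].

Definition posvec_subn x y : {ffun 'I_n -> nat} :=
  [ffun i => (val (x i) - val (y i))%N].

Lemma posvec_addnE x v i : val (posvec_addn x v i) = (val (x i) + v i)%N.
Proof. by rewrite ffunE. Qed.

Lemma to_zvec_addn x v i : to_zvec (posvec_addn x v) i = Posz (val (x i) + v i).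
Proof. by rewrite ffunE posvec_addnE. Qed.

Lemma lev_addn x v : lev x (posvec_addn x v).
Proof. by move=> i; rewrite posvec_addnE leq_addr. Qed.

Lemma posvec_addnK x v : posvec_subn (posvec_addn x v) x = v.
Proof. by apply/ffunP => i; rewrite ffunE posvec_addnE addKn. Qed.

Lemma posvec_subnK x y : lev y x -> posvec_addn y (posvec_subn x y) = x.
Proof.
move=> yx; apply/ffunP => i; apply: val_inj.
by rewrite posvec_addnE ffunE subnKC.
Qed.

Definition posvec1 : posvec n :=
  [ffun=> exist (fun k => is_true (0 < k)%N) 1%N (erefl _)].

Lemma ipf_dom a z : (exists w, a z = Some w) <-> lev (ipf_x a) z.
Proof. by change (pdom a z <-> up (ipf_x a) z); have [-> _ _] := ipf_xyP a. Qed.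

Lemma ipf_ran a w : (exists z, a z = Some w) <-> lev (ipf_y a) w.
Proof. by change (pran a w <-> up (ipf_y a) w); have [_ -> _] := ipf_xyP a. Qed.

Lemma ipf_le a z z' w w' :
  a z = Some w -> a z' = Some w' -> lev z z' <-> lev w w'.
Proof. by have [_ _] := ipf_xyP a; apply. Qed.

(** Translating the least points of domain and range to the origin turns [a] into an order
    automorphism [f] of the tuples of naturals, with inverse [g]. *)
Lemma ipf_perm_exists a : exists s, is_ipf_perm a s.
Proof.
set x := ipf_x a; set y := ipf_y a.
have imP v : {w | a (posvec_addn x v) = Some w}.
  by apply: cid; apply/ipf_dom; exact: lev_addn.
have preP v : {z | a z = Some (posvec_addn y v)}.
  by apply: cid; apply/ipf_ran; exact: lev_addn.
have imy z w : a z = Some w -> lev y w by move=> zw; apply/ipf_ran; exists z.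
have prex z w : a z = Some w -> lev x z by move=> zw; apply/ipf_dom; exists w.
pose f v := posvec_subn (sval (imP v)) y.
pose g v := posvec_subn (sval (preP v)) x.
have a_inj z z' w : a z = Some w -> a z' = Some w -> z = z'.
  move=> zw z'w.
  by apply: lev_anti; [apply/(ipf_le zw z'w) | apply/(ipf_le z'w zw)].
have fE v w : a (posvec_addn x v) = Some w -> f v = posvec_subn w y.
  by move=> xw; rewrite /f; case: (imP v) => w' /=; rewrite xw => -[->].
have fK : cancel f g.
  move=> v; rewrite /g; case: (preP _) => z /=; rewrite /f.
  case: (imP v) => w /= xw; rewrite posvec_subnK; last exact: imy xw.
  by move=> /(a_inj _ _ _ xw) <-; rewrite posvec_addnK.
have gK : cancel g f.
  move=> v; rewrite /g; case: (preP v) => z /= zw.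
  rewrite (fE _ (posvec_addn y v)) ?posvec_addnK// posvec_subnK//.
  exact: prex zw.
have [s sP] : exists s : 'S_n, forall v i, f v (s i) = v i.
  apply: (order_automorphism_perm fK gK) => v v'.
  rewrite /f; case: (imP v) => w /= vw; case: (imP v') => w' /= vw'.
  have yw := imy _ _ vw; have yw' := imy _ _ vw'.
  have := ipf_le vw vw'; rewrite /lev /levec => vvww.
  split=> [vv' i|ww' i].
    have /vvww /(_ i) : forall i,
        (val (posvec_addn x v i) <= val (posvec_addn x v' i))%N.
      by move=> j; rewrite !posvec_addnE leq_add2l.
    by rewrite !ffunE; lia.
  have /vvww /(_ i) : forall i, (val (w i) <= val (w' i))%N.
    move=> j; have := ww' j; have := yw j; have := yw' j.
    by rewrite !ffunE; lia.
  by rewrite !posvec_addnE leq_add2l.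
exists s => z w zw; apply/ffunP => i; rewrite !ffunE.
have xz := prex _ _ zw; have yw := imy _ _ zw.
have := sP (posvec_subn z x) (s^-1 i)%g.
rewrite permKV (fE _ w) ?posvec_subnK// !ffunE.
have := xz (s^-1 i)%g; have := yw i; rewrite -/x -/y; lia.
Qed.

(** Permuting [zone] does not change it, so the two constants cancel: [Upsilon a] encodes the affine
    map that [a] restricts. *)
Lemma UpsilonP a z w :
  a z = Some w ->
  to_zvec w = (zperm (to_zvec z) (Upsilon a).1 - (Upsilon a).2)%R.
Proof.
have : is_ipf_perm a (ipf_perm a).
  by rewrite /ipf_perm; case: xgetP => // no; have [s /no] := ipf_perm_exists a.
by move=> aP /aP ->; apply/ffunP => i; rewrite /Upsilon /= !ffunE; lia.
Qed.

(** An affine map is determined by its values on any filter: raising one coordinate of [x] by 1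
    reveals the permutation, and the value at [x] then reveals the translation. *)
Lemma Upsilon_unique a (p : perm_zvec n) x :
  (forall z, lev x z -> exists2 w,
     a z = Some w & to_zvec w = (zperm (to_zvec z) p.1 - p.2)%R) ->
  Upsilon a = p.
Proof.
move=> ap.
have E z i : lev x z ->
    ((to_zvec z) (((Upsilon a).1)^-1%g i) - (Upsilon a).2 i =
     (to_zvec z) ((p.1)^-1%g i) - p.2 i)%R.
  move=> /ap[w aw]; rewrite (UpsilonP aw) => /ffunP/(_ i).
  by rewrite !ffunE.
case: (Upsilon a) p {ap} E => s t [s' t'] /= E.
have st i : ((s^-1)%g i = (s'^-1)%g i)%g.
  have := E (posvec_addn x (axis 1 (s^-1 i)%g)) i (lev_addn _ _).
  have := E x i (@lev_refl _ _).
  rewrite !to_zvec_addn axisE [to_zvec x _]ffunE [to_zvec x (s'^-1%g i)]ffunE.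
  rewrite [axis _ _ _]ffunE; case: ((s'^-1)%g i =P (s^-1)%g i) => [->//|_].
  by rewrite addn0 addn1; lia.
have ss' : s = s' by apply: invg_inj; apply/permP.
subst s'; congr pair; apply/ffunP => i; have := E x i (@lev_refl _ _).
by move/addrI/oppr_inj.
Qed.

Lemma ipf_mulP a b z w : (a * b)%g z = Some w <->
  exists2 t, a z = Some t & b t = Some w.
Proof.
change ((a * b)%g z) with (obind b (a z)).
case: (a z) => [t|] /=; last by split=> // -[].
by split=> [bw|[t' [<-]]//]; exists t.
Qed.

Lemma UpsilonM a b : Upsilon (a * b)%g = (Upsilon a * Upsilon b)%g.
Proof.
apply: (@Upsilon_unique _ _ (ipf_x (a * b)%g)) => z /ipf_dom[w abw].
exists w => //; move/ipf_mulP: abw => [t /UpsilonP at_ /UpsilonP ->].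
by rewrite at_ zpermD zpermN -zpermM -addrA -opprD.
Qed.

Lemma ipf_ext a b : (forall z w, a z = Some w <-> b z = Some w) -> a = b.
Proof.
move=> ab; apply: ipf_inj; apply: funext => z.
case az : (a z) => [w|]; first by symmetry; apply/ab.
by case bz : (b z) => [w|//]; move/ab : bz; rewrite az.
Qed.

Definition filter_iso_fun s x y z : option (posvec n) :=
  if [forall i, val (x i) <= val (z i)]%N
  then Some (posvec_addn y [ffun j => posvec_subn z x ((s^-1)%g j)]) else None.

(** This form avoids truncated subtraction and inverse permutations, so that later identities become
    linear arithmetic. *)
Lemma filter_iso_funP s x y z w : filter_iso_fun s x y z = Some w <->
  [/\ lev x z, lev y w & forall i,
    (val (w (s i)) + val (x i) = val (z i) + val (y (s i)))%N].
Proof.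
rewrite /filter_iso_fun; case: ifP => [/forallP xz|/negP xz]; last first.
  by split=> // -[xz' _ _]; case: xz; apply/forallP.
split=> [[<-]|[_ yw wz]].
  split=> // [|i]; first exact: lev_addn.
  by rewrite posvec_addnE !ffunE permK; have := xz i; lia.
congr Some; apply/ffunP => j; apply: val_inj; rewrite posvec_addnE !ffunE.
have := wz ((s^-1)%g j); have := xz ((s^-1)%g j); rewrite permKV => xz' wz'.
by rewrite addnBA// [X in (X - _)%N]addnC -wz' addnK.
Qed.

Lemma filter_iso_dom s x y z :
  lev x z -> exists w, filter_iso_fun s x y z = Some w.
Proof.
by rewrite /filter_iso_fun => xz; case: ifP => [_|/forallP//]; eexists.
Qed.

Lemma filter_iso_is_ipf s x y : is_ipf (filter_iso_fun s x y).
Proof.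
exists x, y; split.
- apply/seteqP; split=> z; last exact: filter_iso_dom.
  by move=> [w /filter_iso_funP[]].
- apply/seteqP; split=> w; first by move=> [z /filter_iso_funP[]].
  move=> /= yw; exists (posvec_addn x [ffun j => posvec_subn w y (s j)]).
  apply/filter_iso_funP; split => // [|i]; first exact: lev_addn.
  by rewrite posvec_addnE !ffunE; have := yw (s i); lia.
- move=> z z' w w' /filter_iso_funP[_ _ zw] /filter_iso_funP[_ _ zw'].
  split=> [zz' i|ww' i].
    have := zw (s^-1 i)%g; have := zw' (s^-1 i)%g; have := zz' (s^-1 i)%g.
    by rewrite permKV; lia.
  by have := zw i; have := zw' i; have := ww' (s i); lia.
Qed.

Definition filter_iso s x y : ipf n := IPF (filter_iso_is_ipf s x y).

Lemma filter_isoM s t x y w :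
  (filter_iso s x y * filter_iso t y w)%g = filter_iso (s * t)%g x w.
Proof.
apply: ipf_ext => z u; rewrite ipf_mulP; split.
  move=> [v /filter_iso_funP[xz yv vz] /filter_iso_funP[_ wu uv]].
  apply/filter_iso_funP; split=> // i; rewrite permM.
  by have := vz i; have := uv (s i); lia.
move=> /filter_iso_funP[xz wu uz].
have [v zv] := filter_iso_dom s y xz; exists v => //.
move/filter_iso_funP: zv => [_ yv vz].
apply/filter_iso_funP; split=> // i.
have := vz (s^-1 i)%g; have := uz (s^-1 i)%g; rewrite permM permKV; lia.
Qed.

Lemma filter_iso_id x z : lev x z -> filter_iso 1%g x x z = Some z.
Proof.
by move=> xz; apply/filter_iso_funP; split=> // i; rewrite perm1 addnC.
Qed.

Lemma Upsilon_surj (p : perm_zvec n) : exists a, Upsilon a = p.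
Proof.
case: p => s t.
(* [x] carries the positive part of [t], moved back along [s], and [y] the negative part; the added
   ones make the coordinates positive and cancel in the difference. *)
pose x := posvec_addn posvec1
  [ffun i => if (0 <= t (s i))%R then `|t (s i)|%N else 0%N].
pose y := posvec_addn posvec1
  [ffun i => if (0 <= t i)%R then 0%N else `|t i|%N].
exists (filter_iso s x y); apply: (@Upsilon_unique _ _ x) => z xz.
have [w zw] := filter_iso_dom s y xz; exists w => //.
move/filter_iso_funP: zw => [_ yv vz]; apply/ffunP => i.
have := vz (s^-1 i)%g; rewrite permKV !posvec_addnE !ffunE permKV /=.
by case: ifP => ?; lia.
Qed.

End Ipf.

(** * Factorization of homomorphisms through [Upsilon] *)

Lemma multiplicative_ext (G H : magmaType) (u v : {multiplicative G -> H}) :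
  u =1 v -> u = v.
Proof.
case: u v => u [[uM]] [v [[vM]]] /= /funext uv.
by case: _ / uv in vM *; rewrite (Prop_irrelevance uM vM).
Qed.

Section Quotient.
Variable n : nat.
Implicit Types (x y z : posvec n) (a b : ipf n).
Local Open Scope group_scope.

Definition ipf_idem x : ipf n := filter_iso 1 x x.

Lemma ipf_idem_mulP x a z w :
  (ipf_idem x * a) z = Some w <-> lev x z /\ a z = Some w.
Proof.
rewrite ipf_mulP; split=> [[t]|[xz azw]]; last first.
  by exists z => //; exact: filter_iso_id.
move=> /[dup] /filter_iso_funP[xz _ _].
by rewrite (filter_iso_id xz) => -[<-].
Qed.

Lemma ipf_idem_mul a : ipf_idem (ipf_x a) * a = a.
Proof.
apply: ipf_ext => z w; rewrite ipf_idem_mulP; split=> [[]//|azw].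
by split=> //; apply/ipf_dom; exists w.
Qed.

(** Both maps restrict the same affine map, so they agree on the intersection of their domains,
    which is the filter of the join of [ipf_x a] and [ipf_x b]; left multiplication by an idempotent
    restricts to a filter. *)
Lemma Upsilon_idem_mul a b : Upsilon a = Upsilon b ->
  exists x, ipf_idem x * a = ipf_idem x * b.
Proof.
move=> ab; exists (maxv (ipf_x a) (ipf_x b)).
apply: ipf_ext => z w; rewrite !ipf_idem_mulP lev_max -!ipf_dom.
suff E t t' : a z = Some t -> b z = Some t' -> t = t'.
  split=> -[[[t azt] [t' bzt']]]; split=> //;
    try by split; [exists t | exists t'].
  - by rewrite bzt' -(E _ _ azt bzt') -azt.
  - by rewrite azt (E _ _ azt bzt') -bzt'.
move=> /UpsilonP azt /UpsilonP; rewrite -ab -azt => /ffunP tt'.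
apply/ffunP => i; apply: val_inj.
by have := tt' i; rewrite !ffunE => -[].
Qed.

Variables (S : semigroupType) (h : {multiplicative ipf n -> S}).
Hypothesis h_idem : forall x y, h (ipf_idem x) = h (ipf_idem y).

(** Each map absorbs the idempotent of its domain on the left, and under [h] that idempotent may be
    exchanged for the one on which the two maps agree. *)
Lemma idem_collapse_factor a b : Upsilon a = Upsilon b -> h a = h b.
Proof.
move=> /Upsilon_idem_mul[x xab].
rewrite -[a]ipf_idem_mul -[b]ipf_idem_mul !gmulfM.
by rewrite (h_idem _ x) (h_idem (ipf_x b) x) -!gmulfM xab.
Qed.

(** The group laws of [perm_zvec n] lift along the surjection [Upsilon] and hold in the image by
    [idem_collapse_factor]. *)
Lemma idem_collapse_is_subgroup : is_subgroup (range h).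
Proof.
have [a1 a1E] := Upsilon_surj (1 : perm_zvec n).
split=> [_ _ [a _ <-] [b _ <-]|]; first by exists (a * b) => //; exact: gmulfM.
exists (h a1) => [|_ [a _ <-]]; first by exists a1.
split.
- by rewrite -gmulfM; apply: idem_collapse_factor; rewrite UpsilonM a1E mul1g.
- by rewrite -gmulfM; apply: idem_collapse_factor; rewrite UpsilonM a1E mulg1.
have [b bE] := Upsilon_surj (Upsilon a)^-1.
exists (h b); first by exists b.
by split; rewrite -gmulfM; apply: idem_collapse_factor;
  rewrite UpsilonM bE a1E ?mulgV ?mulVg.
Qed.

Lemma idem_collapse_universal :
  exists! u : {multiplicative perm_zvec n -> S}, forall a, h a = u (Upsilon a).
Proof.
(* [r] chooses preimages under [Upsilon]; the choice does not affect [h \o r], which is therefore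
   multiplicative. *)
have [r rK] := choice (@Upsilon_surj n).
have uM : {morph (h \o r) : p q / p * q}.
  move=> p q /=; rewrite -gmulfM; apply: idem_collapse_factor.
  by rewrite UpsilonM !rK.
pose u := HB.pack_for {multiplicative perm_zvec n -> S} (h \o r)
  (isMultiplicative.Build _ _ _ uM).
exists u; split=> [a|v hv].
  by apply: idem_collapse_factor; rewrite rK.
by apply: multiplicative_ext => p; rewrite /= hv rK.
Qed.

End Quotient.

Theorem corollary3p3 (R : realType) (n : nat) (n_gt0 : (0 < n)%N)
  (S : topologicalSemigroupType) (S_hausdorff : hausdorff_space S)
  (S_cond :
       compact [set: S]
    \/ gamma_compact S
    \/ (countably_compact S /\ topological_inverse_semigroup S)
    \/ countably_compact (S * S)%type
    \/ pseudocompact R (S * S)%type) :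
  (~ exists h : {multiplicative ipf n -> S}, injective h) /\
  (forall h : {multiplicative ipf n -> S}, is_subgroup (range h)) /\
  (forall h : {multiplicative ipf n -> S},
     exists! u : {multiplicative perm_zvec n -> S},
       forall a : ipf n, h a = u (Upsilon a)).
Proof.
pose one := posvec1 n.
have one_le (x : posvec n) : lev one x.
  by move=> i; rewrite ffunE; exact: valP (x i).
have isoM (x y z : posvec n) :
    (filter_iso 1 x y * filter_iso 1 y z = filter_iso 1 x z)%g.
  by rewrite filter_isoM mulg1.
have h_idem_one (h : {multiplicative ipf n -> S}) x :
    h (ipf_idem x) = h (ipf_idem one).
  (* The collapse is applied with [p] the image of the isomorphism from the filter of [one] onto
     that of [x], and [q] the image of its inverse. *)
  rewrite -[ipf_idem x](isoM x one x) -[ipf_idem one](isoM one x one) !gmulfM.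
  apply: (bicyclic_collapse S_hausdorff S_cond); rewrite -!gmulfM !isoM//.
  (* What remains is that [ipf_idem one] is neutral on either side; it is the identity map, since
     every point lies above [one]. *)
  - congr (h _); apply: ipf_ext => z w; rewrite ipf_mulP.
    split=> [[t zt]|zw]; first by rewrite filter_iso_id// => -[<-].
    by exists w => //; exact: filter_iso_id.
  - congr (h _); apply: ipf_ext => z w; rewrite ipf_idem_mulP.
    by split=> [[]|].
have h_idem (h : {multiplicative ipf n -> S}) x y :
  h (ipf_idem x) = h (ipf_idem y) by rewrite !(h_idem_one h).
split; last first.
  by split=> h;
    [exact: idem_collapse_is_subgroup | exact: idem_collapse_universal].
move=> [h h_inj].
(* [ipf_idem one] is defined at [one], whereas [ipf_idem two] is not, since there is at least one
   coordinate; yet injectivity would identify them. *)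
pose two := posvec_addn one [ffun=> 1%N].
have /h_inj/(congr1 (fun a : ipf n => a one)) := h_idem h one two.
rewrite (filter_iso_id (@lev_refl _ _)) => /esym/filter_iso_funP[].
move=> /(_ (Ordinal n_gt0)).
by rewrite posvec_addnE !ffunE.
Qed.
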